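(* Let $n \geq 1$ and $m \geq 2$ be integers. Let $a_i^{(k)} \in \mathbb{R}_+$ for $i \in \{1,2,\dots,n\}$ and $k \in \{1,2,\dots,m\}$, and let $p_k \in (1,+\infty)$ for $k \in \{1,2,\dots,m\}$ be real numbers such that $$\frac{1}{p_1} + \frac{1}{p_2} + \cdots + \frac{1}{p_m} = 1.$$ Then $$\sum_{i=1}^{n} \prod_{k=1}^{m} a_i^{(k)} \leq \prod_{k=1}^{m} \left( \sum_{i=1}^{n} \left(a_i^{(k)}\right)^{p_k} \right)^{\frac{1}{p_k}}.$$
   Context: $\mathbb{R}_+$ denotes the set of nonnegative real numbers. The superscript $(k)$ in $a_i^{(k)}$ is an index, not an exponent. *)

(* Defs.v *)
From HB Require Import structures.
From mathcomp Require Import all_boot all_order all_algebra.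
From mathcomp Require Import reals exp.

Set Implicit Arguments.
Unset Strict Implicit.
Unset Printing Implicit Defensive.

(* Main.v *)
Require Import Defs.
From HB Require Import structures.
From mathcomp Require Import all_boot all_order all_algebra.
From mathcomp Require Import sequences reals exp.

Set Implicit Arguments.
Unset Strict Implicit.
Unset Printing Implicit Defensive.

Import Order.TTheory GRing.Theory Num.Theory.

Local Open Scope ring_scope.

(** With weights [w k = 1 / p k] and [x i k = a i k `^ p k], the claim reads
    [\sum_i \prod_k x i k `^ w k <= \prod_k (\sum_i x i k) `^ w k].
    Normalizing so that every column sum [\sum_i x i k] is 1, it follows by
    summing over [i] the weighted AM-GM inequality for each row; AM-GM itself
    comes from [1 + t <= expR t] at [t = x k / A - 1], [A] the weighted mean. *)

(** Raise [x / A <= expR (x / A - 1)] to the power [w]. The exponent on the right is affine in [x],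
    so when such bounds are multiplied the exponents add up and can cancel. *)
Lemma powR_le_expR (R : realType) (A x w : R) :
  0 < A -> 0 <= x -> 0 <= w -> x `^ w <= A `^ w * expR (w * (x / A - 1)).
Proof.
move=> A0 x0 w0; have xA0 : 0 <= x / A by rewrite divr_ge0// ltW.
have -> : x `^ w = A `^ w * (x / A) `^ w.
  by rewrite -powRM ?(ltW A0)// mulrC divfK// gt_eqF.
rewrite ler_wpM2l ?powR_ge0// (mulrC w) expRM.
apply: ge0_ler_powR; rewrite ?nnegrE ?expR_ge0//.
by apply: le_trans (expR_ge1Dx _); rewrite addrC subrK.
Qed.

Lemma prod_powRr (R : realType) (K : finType) (A : R) (w : K -> R) :
  0 < A -> \prod_k A `^ w k = A `^ (\sum_k w k).
Proof.
move=> A0; elim/big_ind2: _ => [|? ? ? ? -> ->|//]; first by rewrite powRr0.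
by rewrite powRD// (gt_eqF A0) implybT.
Qed.

Lemma weighted_AGM (R : realType) (K : finType) (w x : K -> R) :
  (forall k, 0 < w k) -> \sum_k w k = 1 -> (forall k, 0 <= x k) ->
  \prod_k x k `^ w k <= \sum_k w k * x k.
Proof.
move=> w0 w1 x0; have wx0 k : 0 <= w k * x k by rewrite mulr_ge0// ltW.
(* A zero mean cannot be divided by, but it forces every [x k] to be 0. Some index exists because
   the weights sum to 1, and its factor annihilates the product. *)
have [sx0|sxN0] := eqVneq (\sum_k w k * x k) 0.
  have [k _|K0] := pickP (@predT K); last first.
    by exfalso; have := oner_neq0 R; rewrite -w1 big_pred0 ?eqxx.
  have /eqP : w k * x k = 0 := psumr_eq0P (fun k _ => wx0 k) sx0 isT.
  rewrite mulf_eq0 gt_eqF//= => /eqP xk0.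
  by rewrite sx0 (bigD1 k)//= xk0 powR0 ?mul0r// gt_eqF.
set A := \sum_k w k * x k in sxN0 *.
have A0 : 0 < A by rewrite lt_def sxN0 sumr_ge0.
apply: (@le_trans _ _ (\prod_k (A `^ w k * expR (w k * (x k / A - 1))))).
  by apply: ler_prod => k _; rewrite powR_ge0 powR_le_expR// ltW.
rewrite big_split /= prod_powRr// w1 powRr1 ?(ltW A0)// -expR_sum.
(* The exponents sum to [A / A - 1 = 0], leaving just [A]. *)
under eq_bigr do rewrite mulrBr mulr1 mulrA.
by rewrite sumrB -mulr_suml w1 divff// subrr expR0 mulr1.
Qed.

Lemma weighted_hoelder (R : realType) (I K : finType) (w : K -> R)
    (x : I -> K -> R) :
  (forall k, 0 < w k) -> \sum_k w k = 1 -> (forall i k, 0 <= x i k) ->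
  \sum_i \prod_k x i k `^ w k <= \prod_k (\sum_i x i k) `^ w k.
Proof.
move=> w0 w1 x0; pose S k := \sum_i x i k.
have S0 k : 0 <= S k by apply: sumr_ge0.
have [/existsP[k /eqP Sk0]|/existsPn SN0] := boolP [exists k, S k == 0].
  (* A zero column cannot be normalized, but it puts a factor 0 in every row product: 0 to the power
     [w k] is 0 since [w k] is nonzero. *)
  rewrite big1 => [|i _]; first by apply: prodr_ge0 => ? _; exact: powR_ge0.
  have xik0 : x i k = 0 := psumr_eq0P (fun i _ => x0 i k) Sk0 isT.
  by rewrite (bigD1 k)//= xik0 powR0 ?mul0r// gt_eqF.
have normalize i : \prod_k x i k `^ w k =
    \prod_k (x i k / S k) `^ w k * \prod_k S k `^ w k.
  rewrite -big_split; apply: eq_bigr => k _ /=.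
  by rewrite -powRM ?divr_ge0// divfK.
rewrite (eq_bigr _ (fun i _ => normalize i)).
rewrite -mulr_suml ler_piMl//; first by apply: prodr_ge0 => ? _; exact: powR_ge0.
(* The normalized sum is at most 1: after AM-GM on each row, column [k] contributes exactly
   [w k]. *)
apply: (@le_trans _ _ (\sum_i \sum_k w k * (x i k / S k))).
  by apply: ler_sum => i _; apply: weighted_AGM => // k; rewrite divr_ge0.
rewrite exchange_big /= -w1; apply: ler_sum => k _.
by rewrite -mulr_sumr -mulr_suml divff ?SN0// mulr1.
Qed.

Theorem mainTheorem1 (R : realType) (n m : nat) (hn : (1 <= n)%N) (hm : (2 <= m)%N)
  (a : 'I_n -> 'I_m -> R) (ha : forall i k, 0 <= a i k)
  (p : 'I_m -> R) (hp : forall k, 1 < p k)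
  (hsum : \sum_(k < m) 1 / p k = 1) :
  \sum_(i < n) \prod_(k < m) a i k
    <= \prod_(k < m) (\sum_(i < n) a i k `^ p k) `^ (1 / p k).
Proof.
have p0 k : 0 < p k by rewrite (lt_trans ltr01).
have aE i k : a i k = (a i k `^ p k) `^ (1 / p k).
  by rewrite -powRrM mul1r divff ?powRr1// gt_eqF.
under eq_bigr do under eq_bigr do rewrite aE.
apply: weighted_hoelder => // [k|i k]; last exact: powR_ge0.
by rewrite divr_gt0.
Qed.
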